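(* Let $\mathfrak K\subset\mathbb N$ be a subsequence. Suppose that (i) $(X,\mathcal B,m,T)$ is an invertible measure preserving transformation which is weakly rationally ergodic along $\mathfrak K$; (ii) there exist a countable partition $\alpha\subset R_{\mathfrak K}(T)$ of $X$, generating $\mathcal B$ under $T$, and a cylinder set $\Omega\in\mathcal C_\alpha$ with $m(\Omega)>0$ such that for all $A,B\in\mathcal C_\alpha$, $$\frac1{a_n(\Omega)}\sum_{k=0}^{n-1}\bigl|m(A\cap T^{-k}B)-m(A)m(B)u_k(\Omega)\bigr|\to0\quad\text{as } n\to\infty,\ n\in\mathfrak K.$$ Then $(X,\mathcal B,m,T)$ is rationally weakly mixing along $\mathfrak K$.
   Context: $(X,\mathcal B,m,T)$ denotes a conservative measure preserving transformation $T$ of a standard $\sigma$-finite measure space ($X$ Polish, $\mathcal B$ its Borel sets, $m$ non-atomic) with $m(X)=\infty$; conservative means $m(A\setminus\bigcup_{n\ge1}T^{-n}A)=0$ for all $A\in\mathcal B$. Write $\mathcal F:=\{A\in\mathcal B: m(A)<\infty\}$, $\mathcal C_+:=\{A\in\mathcal C: m(A)>0\}$ for $\mathcal C\subset\mathcal B$, and $\mathcal B\cap F:=\{A\in\mathcal B:A\subset F\}$. A subsequence $\mathfrak K\subset\mathbb N$ is an infinite subset. A countable partition $\alpha\subset\mathcal B$ generates $\mathcal B$ under the invertible $T$ if $\sigma(\bigcup_{n\in\mathbb Z}T^n\alpha)=\mathcal B$ (mod $m$). The $(\alpha,T)$-cylinder sets are $$\mathcal C_\alpha:=\Bigl\{[a_1,\dots,a_N]_k:=\bigcap_{j=1}^NT^{-(j+k)}a_j:\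 N\in\mathbb N,\ k\in\mathbb Z,\ a_1,\dots,a_N\in\alpha\Bigr\}.$$ For $F\in\mathcal F_+$: $u_n(F):=\frac{m(F\cap T^{-n}F)}{m(F)^2}$ and $a_n(F):=\sum_{k=0}^{n-1}u_k(F)$. A conservative, ergodic $T$ is rationally weakly mixing along $\mathfrak K$ if there is $F\in\mathcal F_+$ such that for all $A,B\in\mathcal B\cap F$, $\frac1{a_n(F)}\sum_{k=0}^{n-1}|m(A\cap T^{-k}B)-m(A)m(B)u_k(F)|\to0$ as $n\to\infty$, $n\in\mathfrak K$. A conservative, ergodic $T$ is weakly rationally ergodic along $\mathfrak K$ if there is $F\in\mathcal F_+$ such that $\frac1{a_n(F)}\sum_{k=0}^{n-1}m(B\cap T^{-k}C)\to m(B)m(C)$ as $n\to\infty$, $n\in\mathfrak K$, for all $B,C\in\mathcal B\cap F$. $R_{\mathfrak K}(T)$ denotes the collection of all $F\in\mathcal F$ with this property (null sets being included by convention). *)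

(* Defs.v *)
From HB Require Import structures.
From mathcomp Require Import all_boot all_order all_algebra.
From mathcomp Require Import all_classical all_reals all_analysis.

Set Implicit Arguments.
Unset Strict Implicit.
Unset Printing Implicit Defensive.

Import Order.TTheory GRing.Theory Num.Theory.
Import numFieldNormedType.Exports.

Local Open Scope classical_set_scope.
Local Open Scope ring_scope.

Definition polish (R : realType) (X : topologicalType) : Prop :=
  (exists2 D : set X, countable D & dense D) /\
  exists dist : X -> X -> R,
    [/\ forall x y, dist x y = 0 <-> x = y,
        forall x y, dist x y = dist y x,
        forall x y z, dist x z <= dist x y + dist y z,
        forall (x : X) (U : set X),
          nbhs x U <-> exists2 e, 0 < e & [set y | dist x y < e] `<=` U
      & forall s : nat -> X,
          (forall e, 0 < e -> exists N : nat, forall i j : nat,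
             (N <= i)%N -> (N <= j)%N -> dist (s i) (s j) < e) ->
          exists l : X, s @ \oo --> l].

Notation borel X := (g_sigma_algebraType (@open X)) (only parsing).

Definition atom (R : realType) (d : measure_display) (X : measurableType d)
    (m : {measure set X -> \bar R}) (A : set X) : Prop :=
  [/\ measurable A, (0 < m A)%E
    & forall B, measurable B -> B `<=` A -> m B = 0%E \/ m (A `\` B) = 0%E].

Definition non_atomic (R : realType) (d : measure_display)
    (X : measurableType d) (m : {measure set X -> \bar R}) : Prop :=
  forall A, ~ atom m A.

Definition measure_preserving (R : realType) (d : measure_display)
    (X : measurableType d) (m : {measure set X -> \bar R}) (T : X -> X) : Prop :=
  measurable_fun setT T /\
  forall A, measurable A -> m (T @^-1` A) = m A.

Definition invertible (d : measure_display) (X : measurableType d)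
    (T : X -> X) : Prop :=
  exists S : X -> X, [/\ cancel T S, cancel S T & measurable_fun setT S].

Definition conservative (R : realType) (d : measure_display)
    (X : measurableType d) (m : {measure set X -> \bar R}) (T : X -> X) : Prop :=
  forall A, measurable A ->
    m (A `\` \bigcup_(n in [set n | (1 <= n)%N]) (iter n T @^-1` A)) = 0%E.

Definition ergodic (R : realType) (d : measure_display)
    (X : measurableType d) (m : {measure set X -> \bar R}) (T : X -> X) : Prop :=
  forall A, measurable A -> T @^-1` A = A -> m A = 0%E \/ m (~` A) = 0%E.

(* Meaningful for 0 < m F < +oo only (fine +oo = 0 and x / 0 = 0). *)
Definition u_ (R : realType) (d : measure_display) (X : measurableType d)
    (m : {measure set X -> \bar R}) (T : X -> X) (F : set X) (n : nat) : R :=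
  fine (m (F `&` iter n T @^-1` F)) / fine (m F) ^+ 2.

Definition a_ (R : realType) (d : measure_display) (X : measurableType d)
    (m : {measure set X -> \bar R}) (T : X -> X) (F : set X) (n : nat) : R :=
  \sum_(0 <= k < n) u_ m T F k.

Definition pos_finite (R : realType) (d : measure_display)
    (X : measurableType d) (m : {measure set X -> \bar R}) (F : set X) : Prop :=
  [/\ measurable F, (0 < m F)%E & (m F < +oo)%E].

Definition mixing_dev (R : realType) (d : measure_display)
    (X : measurableType d) (m : {measure set X -> \bar R}) (T : X -> X)
    (F A B : set X) (n : nat) : R :=
  (a_ m T F n)^-1 *
  \sum_(0 <= k < n)
    `| fine (m (A `&` iter k T @^-1` B))
       - fine (m A) * fine (m B) * u_ m T F k |.

Definition rationally_weakly_mixing (R : realType) (d : measure_display)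
    (X : measurableType d) (m : {measure set X -> \bar R}) (T : X -> X)
    (K : set nat) : Prop :=
  [/\ conservative m T, ergodic m T
    & exists2 F, pos_finite m F &
        forall A B, measurable A -> measurable B -> A `<=` F -> B `<=` F ->
          mixing_dev m T F A B @ within K \oo --> (0 : R)].

Definition wre_along (R : realType) (d : measure_display)
    (X : measurableType d) (m : {measure set X -> \bar R}) (T : X -> X)
    (K : set nat) (F : set X) : Prop :=
  forall B C, measurable B -> measurable C -> B `<=` F -> C `<=` F ->
    (fun n => (a_ m T F n)^-1 *
              \sum_(0 <= k < n) fine (m (B `&` iter k T @^-1` C)))
      @ within K \oo --> fine (m B) * fine (m C).

Definition weakly_rationally_ergodic (R : realType) (d : measure_display)
    (X : measurableType d) (m : {measure set X -> \bar R}) (T : X -> X)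
    (K : set nat) : Prop :=
  [/\ conservative m T, ergodic m T
    & exists2 F, pos_finite m F & wre_along m T K F].

(* The collection R_K(T); null sets belong to it by convention. *)
Definition wre_sets (R : realType) (d : measure_display)
    (X : measurableType d) (m : {measure set X -> \bar R}) (T : X -> X)
    (K : set nat) : set (set X) :=
  [set F | [/\ measurable F, (m F < +oo)%E & m F = 0%E \/ wre_along m T K F]].

(* T^n A for n : int; for n < 0 this is a preimage, so no inverse map of T has
   to be named. *)
Definition zimage (X : Type) (T : X -> X) (n : int) (A : set X) : set X :=
  match n with
  | Posz k => iter k T @` A
  | Negz k => iter k.+1 T @^-1` A
  end.

Definition cylinders (X : Type) (T : X -> X) (alpha : set (set X)) :
    set (set X) :=
  [set C | exists (N : nat) (k : int) (a : nat -> set X),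
    [/\ (1 <= N)%N,
        forall j, (1 <= j <= N)%N -> alpha (a j)
      & C = \bigcap_(j in [set j | (1 <= j <= N)%N])
              zimage T (- (j%:Z + k)) (a j)]].

(* The other inclusion of sigma(...) = B (mod m) is automatic when the members
   of alpha are measurable and T is bimeasurable. *)
Definition generates (R : realType) (d : measure_display)
    (X : measurableType d) (m : {measure set X -> \bar R}) (T : X -> X)
    (alpha : set (set X)) : Prop :=
  forall B, measurable B ->
    exists2 A, <<s [set zimage T n a | n in [set: int] & a in alpha] >> A
             & m (A `+` B) = 0%E.

(* Main.v *)
Require Import Defs.
From HB Require Import structures.
From mathcomp Require Import all_boot all_order all_algebra.
From mathcomp Require Import all_classical all_reals all_analysis.
From mathcomp Require Import ring lra zify.

Import Order.TTheory GRing.Theory Num.Theory.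
Import numFieldNormedType.Exports.

Local Open Scope classical_set_scope.
Local Open Scope ring_scope.

(** The mixing set is [Omega] itself. It lies in a translate of one block of
    [alpha], and comparing [a_n] of the two sets shows that [Omega] is again in
    [R_K(T)]. Weak rational ergodicity on [Omega] bounds the averaged deviation
    of a pair [A, B] of subsets of [Omega] by about [2 m(A) m(B)]; hence, with
    one set of the pair fixed, the sets with vanishing deviation are closed
    under proper differences and increasing unions, i.e. form a lambda-system.
    Cylinders over symmetric windows [-n, n] containing the window of [Omega]
    are nested or disjoint, so they form (with the empty set) a pi-system; it
    generates the sigma-algebra because [alpha] is countable. The pi-lambda
    theorem, applied in [B] and then in [A], gives the result. *)

(** * Averaged deviations along a filter and their lambda-system *)

Section averaged_deviation.
Context {R : realType} {d : measure_display} {X : measurableType d}.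
Variable m : {measure set X -> \bar R}.

Lemma preimage_measurable {d' : measure_display} {Y : measurableType d'}
    (f : X -> Y) (B : set Y) :
  measurable_fun setT f -> measurable B -> measurable (f @^-1` B).
Proof. by move=> mf mB; rewrite -(setTI (f @^-1` B)); exact: mf. Qed.

Lemma measure_lty_subset (A B : set X) : measurable A -> measurable B ->
  A `<=` B -> (m B < +oo)%E -> (m A < +oo)%E.
Proof.
by move=> mA mB AB; apply: le_lt_trans; apply: le_measure; rewrite ?inE.
Qed.

Lemma fine_measure_setID (E : set X) (f : X -> X) (A B : set X) :
  measurable E -> (m E < +oo)%E -> measurable_fun setT f ->
  measurable A -> measurable B -> B `<=` A ->
  fine (m (E `&` f @^-1` (A `\` B))) =
  fine (m (E `&` f @^-1` A)) - fine (m (E `&` f @^-1` B)).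
Proof.
move=> mE Efin mf mA mB BA.
have mEA : measurable (E `&` f @^-1` A).
  by apply: measurableI => //; exact: preimage_measurable.
have mEB : measurable (E `&` f @^-1` B).
  by apply: measurableI => //; exact: preimage_measurable.
have fA : (m (E `&` f @^-1` A) < +oo)%E by apply: measure_lty_subset mE _ Efin.
have fB : (m (E `&` f @^-1` B) < +oo)%E by apply: measure_lty_subset mE _ Efin.
have -> : E `&` f @^-1` (A `\` B) = (E `&` f @^-1` A) `\` (E `&` f @^-1` B).
  apply/seteqP; split => x /=; first by move=> [Ex [Ax Bx]]; split => // -[].
  by move=> [[Ex Ax] EBx]; split=> //; split=> // Bx; exact: EBx.
rewrite measureD// (_ : _ `&` (E `&` _) = E `&` f @^-1` B); last first.
  apply/seteqP; split => x /=; first by move=> [_].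
  by move=> [Ex Bx]; split=> //; split=> //; exact: BA.
by rewrite fineB// fin_num_abs gee0_abs.
Qed.

Variables (G : set_system nat) (FG : Filter G).
Variables (E : nat -> set X) (g : nat -> X -> X) (O : set X) (c : R).
Variable u : nat -> R.
Hypotheses (mE : forall k, measurable (E k)).
Hypotheses (Efin : forall k, (m (E k) < +oo)%E).
Hypotheses (mg : forall k, measurable_fun setT (g k)).
Hypotheses (mO : measurable O) (Ofin : (m O < +oo)%E) (c_ge0 : 0 <= c).
Hypotheses (u_ge0 : forall k, 0 <= u k).
Hypothesis sum_u_gt0 : \forall n \near G, 0 < \sum_(0 <= k < n) u k.

Local Notation nu k B := (fine (m (E k `&` g k @^-1` B))).
Local Notation mu B := (fine (m (O `&` B))).

(** Keeping [E], [g] and [c] abstract lets one argument serve both variables of [mixing_dev]: [g k]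
    is $T^k$ when the second set varies and the identity when the first one does, while [c] is the
    measure of the set held fixed. [average_cvg] below is then weak rational ergodicity on [O]. *)
Definition averaged_dev (B : set X) (n : nat) : R :=
  (\sum_(0 <= k < n) u k)^-1 *
  \sum_(0 <= k < n) `|nu k B - c * mu B * u k|.

Hypothesis average_cvg : forall B, measurable B ->
  (fun n => (\sum_(0 <= k < n) u k)^-1 * \sum_(0 <= k < n) nu k B)
    @ G --> c * mu B.

Let inv_ge0 n : 0 <= (\sum_(0 <= k < n) u k)^-1.
Proof. by rewrite invr_ge0 sumr_ge0. Qed.

Let averaged_dev_ge0 B n : 0 <= averaged_dev B n.
Proof. by rewrite mulr_ge0// sumr_ge0. Qed.

Let muD A B : measurable A -> measurable B -> B `<=` A ->
  mu (A `\` B) = mu A - mu B.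
Proof. by move=> mA mB BA; rewrite (@fine_measure_setID O id). Qed.

Let averaged_devD A B n : measurable A -> measurable B -> B `<=` A ->
  averaged_dev (A `\` B) n <= averaged_dev A n + averaged_dev B n.
Proof.
move=> mA mB BA; rewrite /averaged_dev -mulrDr ler_wpM2l// -big_split/=.
apply: ler_sum => k _; rewrite fine_measure_setID// muD//.
rewrite (_ : _ - _ = (nu k A - c * mu A * u k) - (nu k B - c * mu B * u k)).
  exact: ler_normB.
by ring.
Qed.

Let averaged_dev_le A B n : measurable A -> measurable B -> B `<=` A ->
  averaged_dev A n <= averaged_dev B n + averaged_dev (A `\` B) n.
Proof.
move=> mA mB BA; rewrite /averaged_dev -mulrDr ler_wpM2l// -big_split/=.
apply: ler_sum => k _; rewrite fine_measure_setID// muD//.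
rewrite (_ : nu k A - c * mu A * u k = (nu k B - c * mu B * u k) +
  (nu k A - nu k B - c * (mu A - mu B) * u k)); last by ring.
exact: ler_normD.
Qed.

(** The triangle inequality, all terms being nonnegative. By [average_cvg] the bound tends to
    [2 * c * mu B], so a set of small measure has eventually small deviation. *)
Let averaged_dev_le_average B n : 0 < \sum_(0 <= k < n) u k ->
  averaged_dev B n <=
  (\sum_(0 <= k < n) u k)^-1 * \sum_(0 <= k < n) nu k B + c * mu B.
Proof.
move=> s_gt0; rewrite /averaged_dev.
(* Writing [c * mu B] as $s^{-1}(s\,c\,\mu B)$, with $s$ the sum of the [u k], gives both summands
   the same prefactor. *)
rewrite -[in leRHS](mulKf (lt0r_neq0 s_gt0) (c * mu B)).
rewrite -mulrDr ler_wpM2l// mulr_suml -big_split/=.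
apply: ler_sum => k _; apply: le_trans (ler_normB _ _) _.
by rewrite !ger0_norm ?mulr_ge0 ?fine_ge0// [u k * _]mulrC.
Qed.

Lemma averaged_dev_lambda_system :
  averaged_dev setT @ G --> 0 ->
  lambda_system setT [set B | measurable B /\ averaged_dev B @ G --> 0].
Proof.
move=> devT; split=> //.
- move=> A B BA [mA dA] [mB dB]; split; first exact: measurableD.
  apply: (squeeze_cvgr (f := cst 0)
    (h := fun n => averaged_dev A n + averaged_dev B n)).
  + by apply: nearW => n; rewrite averaged_dev_ge0 averaged_devD.
  + exact: cvg_cst.
  + by rewrite -[X in _ --> X]addr0; exact: cvgD.
- move=> F ndF FP.
  have mF i : measurable (F i) by have [] := FP i.
  set A := \bigcup_i F i.
  have mA : measurable A by exact: bigcup_measurable.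
  split=> //.
  have FA i : F i `<=` A by move=> x Fx; exists i.
  (* Continuity from below along the sets [O] ∩ [F i]; finiteness of [m O] carries it through
     [fine]. *)
  have muF : (fun i => c * mu (A `\` F i)) @ \oo --> 0.
    rewrite -(mulr0 c) -(subrr (mu A)); under eq_fun do rewrite muD//.
    apply: cvgMr; apply: cvgB; first exact: cvg_cst.
    apply: fine_cvg; rewrite fineK; last first.
      rewrite ge0_fin_numE//; apply: measure_lty_subset mO _ Ofin => //.
      exact: measurableI.
    rewrite /A setI_bigcupr.
    apply: (@nondecreasing_cvg_mu _ _ _ m (fun i => O `&` F i)).
    + by move=> i; exact: measurableI.
    + by apply: bigcup_measurable => i _; exact: measurableI.
    + by move=> i j ij; apply/subsetPset; apply: setIS; apply/subsetPset/ndF.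
  apply/cvgr0Pnorm_lt => e e_gt0.
  (* Three quantities will be kept below [e / 4]: the deviation of [F N], the average on the
     remainder [A] minus [F N], and [c] times the measure of that remainder. *)
  have [N _ /(_ N (leqnn _))/= muN] := cvgr0_norm_lt _ muF (e / 4) ltac:(lra).
  have {}muN : c * mu (A `\` F N) < e / 4.
    by apply: le_lt_trans muN; exact: ler_norm.
  have mAN : measurable (A `\` F N) by exact: measurableD.
  near=> n; rewrite ger0_norm//.
  have := averaged_dev_le A (F N) n mA (mF N) (FA N).
  have := averaged_dev_le_average (A `\` F N) n.
  have -> : 0 < \sum_(0 <= k < n) u k by near: n.
  move=> /(_ isT).
  have : (\sum_(0 <= k < n) u k)^-1 * \sum_(0 <= k < n) nu k (A `\` F N) < e / 4.
    by near: n; apply: cvgr_lt muN; exact: average_cvg.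
  have : averaged_dev (F N) n < e / 4.
    near: n; apply: (cvgr_lt 0); last by lra.
    by have [] := FP N.
  by lra.
Unshelve. all: by end_near.
Qed.

Lemma averaged_dev_cvg0 (P : set (set X)) (B : set X) :
  setI_closed P -> P `<=` measurable ->
  (forall A, P A -> averaged_dev A @ G --> 0) -> averaged_dev setT @ G --> 0 ->
  <<s P >> B -> measurable B /\ averaged_dev B @ G --> 0.
Proof.
move=> PI mP Pdev Tdev.
apply: (lambda_system_subset PI (averaged_dev_lambda_system Tdev)) => //.
by move=> A PA; split; [exact: mP|exact: Pdev].
Qed.

End averaged_deviation.

(** * Cylinders over symmetric windows: pi-system and generation *)

Section window_cylinders.
Context {X : Type}.
Variables (phi : int -> X -> X) (alpha : set (set X)).
Hypothesis alpha_partition : partition alpha id [set: X].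

Definition itinerary_cyl (J : set int) (f : int -> set X) : set X :=
  \bigcap_(i in J) phi i @^-1` (f i).

Definition window (n : nat) : set int := [set i | (`|i| <= n)%N].

Definition window_cyls (n : nat) : set (set X) :=
  [set C | exists2 f, (forall i, window n i -> alpha (f i))
                    & C = itinerary_cyl (window n) f].

(** The empty set is adjoined because disjoint cylinders meet in it. The lower bound [n0] will force
    every window to contain that of [Omega]. *)
Definition window_pi_system (n0 : nat) : set (set X) :=
  [set C | C = set0 \/ exists2 n, (n0 <= n)%N & window_cyls n C].

(** Blocks of a partition are equal or disjoint: agreement of [f] and [f'] on [J] gives inclusion,
    and a single disagreement there gives disjointness. *)
Lemma itinerary_cyl_sub_or_disjoint (J J' : set int) (f f' : int -> set X) :
  J `<=` J' ->
  (forall i, J i -> alpha (f i)) -> (forall i, J' i -> alpha (f' i)) ->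
  itinerary_cyl J' f' `<=` itinerary_cyl J f \/
  itinerary_cyl J' f' `&` itinerary_cyl J f = set0.
Proof.
move=> JJ' fa fa'; have [_ triv _] := alpha_partition.
have [eqf|/existsNP[i /not_implyP[Ji nf]]] := pselect (forall i, J i -> f i = f' i).
  by left=> x Cx i Ji; rewrite eqf//; exact/Cx/JJ'.
right; apply/seteqP; split=> // x [Cx' Cx]; apply: nf.
apply: (triv (f i) (f' i)); [exact: fa|exact/fa'/JJ'|].
by exists (phi i x); split; [exact: Cx|exact/Cx'/JJ'].
Qed.

Lemma window_le (n n' : nat) : (n <= n')%N -> window n `<=` window n'.
Proof. by move=> nn' i /leq_trans; exact. Qed.

Lemma window_pi_system_setI (n0 : nat) : setI_closed (window_pi_system n0).
Proof.
have nested n n' C C' : (n0 <= n')%N -> (n <= n')%N ->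
    window_cyls n C -> window_cyls n' C' -> window_pi_system n0 (C' `&` C).
  move=> n0n' nn' [f fa ->] WC'; have [f' fa' C'E] := WC'; rewrite C'E.
  have [/setIidl ->|->] :=
    itinerary_cyl_sub_or_disjoint _ _ f f' (window_le _ _ nn') fa fa'.
    by right; exists n' => //; rewrite -C'E.
  by left.
move=> A B [->|[n n0n WA]]; first by rewrite set0I; left.
move=> [->|[n' n0n' WB]]; first by rewrite setI0; left.
have [nn'|/ltnW n'n] := leqP n n'; first by rewrite setIC; exact: nested WA WB.
exact: nested WB WA.
Qed.

(** Induction on [n]: enlarging the window by one step adds only the two coordinates [n + 1] and
    [-(n + 1)], so a new cylinder is determined by an old one and two blocks. *)
Lemma countable_window_cyls (n : nat) :
  countable alpha -> countable (window_cyls n).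
Proof.
move=> alphaC; elim: n => [|n IH].
  apply: (@sub_countable _ _ _ ((fun a => phi 0 @^-1` a) @` alpha)); last first.
    exact: sub_countable (card_image_le _ _) alphaC.
  apply: subset_card_le => _ [f fa ->]; exists (f 0); first exact: fa.
  apply/seteqP; split=> [x fx i|x]; last exact.
  by rewrite /window/= leqn0 absz_eq0 => /eqP ->.
pose join (p : set X * (set X * set X)) : set X :=
  p.1 `&` (phi n.+1%:Z @^-1` p.2.1 `&` phi (- n.+1%:Z) @^-1` p.2.2).
apply: (@sub_countable _ _ _ (join @` (window_cyls n `*` (alpha `*` alpha)))).
  apply: subset_card_le => _ [f fa ->].
  exists (itinerary_cyl (window n) f, (f n.+1%:Z, f (- n.+1%:Z))).
    split=> /=.
      by exists f => // i /(window_le n n.+1 (leqnSn n)); exact: fa.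
    by split; apply: fa; rewrite /window/=; lia.
  apply/seteqP; split=> x /=.
    move=> [Cx [x1 x2]] i iw.
    have [wi|wi] := leqP `|i|%N n; first exact: Cx.
    have [->//|->//] : i = n.+1%:Z \/ i = - n.+1%:Z by rewrite /window/= in iw; lia.
  move=> Cx; split; last by split; apply: Cx; rewrite /window/=; lia.
  by move=> i /(window_le n n.+1 (leqnSn n)); exact: Cx.
apply: sub_countable (card_image_le _ _) _.
by apply: countableX => //; exact: countableX.
Qed.

Lemma sigma_algebra_countable_bigcup (P D : set (set X)) :
  countable D -> D `<=` <<s P >> -> <<s P >> (\bigcup_(C in D) C).
Proof.
move=> /countable_injP[h hinj] DP.
(* The union is reindexed by [nat] through the injection [h]; each inner union then has at most one
   member. *)
rewrite (_ : \bigcup_(C in D) C =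
  \bigcup_i \bigcup_(C in [set C | D C /\ h C = i]) C); last first.
  apply/seteqP; split=> x; first by move=> [C DC Cx]; exists (h C) => //; exists C.
  by move=> [i _ [C [DC _] Cx]]; exists C.
apply: sigma_algebra_bigcup => i.
have [[C DC hC]|nC] := pselect (exists2 C, D C & h C = i).
  rewrite (_ : \bigcup_(C in _) _ = C); first exact: DP.
  apply/seteqP; split=> x; last by exists C.
  by move=> [C' [DC' hC'] C'x]; rewrite -(hinj C' C) ?inE// hC' hC.
rewrite (_ : \bigcup_(C in _) _ = set0); first exact: sigma_algebra0.
by apply/seteqP; split=> // x [C [DC hC] _]; apply: nC; exists C.
Qed.

(** Once the window contains [i], the set is the union of the window cylinders inside it, and there
    are only countably many of these. *)
Lemma window_pi_system_generates (n0 : nat) (i : int) (a : set X) :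
  countable alpha -> alpha a -> <<s window_pi_system n0 >> (phi i @^-1` a).
Proof.
move=> alphaC aa; pose n := maxn n0 `|i|%N.
rewrite (_ : phi i @^-1` a =
  \bigcup_(C in [set C | window_cyls n C /\ C `<=` phi i @^-1` a]) C).
  apply: sigma_algebra_countable_bigcup.
    apply: sub_countable (countable_window_cyls n alphaC).
    by apply: subset_card_le => C [].
  move=> C [WC _]; apply: sub_sigma_algebra; right; exists n => //.
  exact: leq_maxl.
apply/seteqP; split=> x; last by move=> [C [_ Ca]]; exact: Ca.
move=> ax; have [cov triv _] := alpha_partition.
have blk j : exists b, alpha b /\ b (phi j x).
  have : [set: X] (phi j x) by [].
  by rewrite -cov => -[b ab bx]; exists b.
(* [f] is the itinerary of [x]; its cylinder contains [x] and, since coordinate [i] is prescribed to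
   be [a], lies in the given set. *)
have [f fP] := choice blk.
exists (itinerary_cyl (window n) f); last by move=> j _; have [] := fP j.
split; first by exists f => // j _; have [] := fP j.
move=> y /(_ i); rewrite /= (triv (f i) a) //; first by apply; exact: leq_maxr.
  by have [] := fP i.
by exists (phi i x); split=> //; have [] := fP i.
Qed.

End window_cylinders.

(** * Integer powers of an invertible map and translation of cylinders *)

Section integer_iterates.
Context {X : Type}.
Variables (T S : X -> X).
Hypotheses (TK : cancel T S) (SK : cancel S T).

(** The power $T^i$, with [S] as inverse; [Negz k] stands for $-(k+1)$, hence [k.+1] copies of
    [S]. *)
Definition int_iter (i : int) : X -> X :=
  match i with Posz k => iter k T | Negz k => iter k.+1 S end.

Let iterTK k : cancel (iter k T) (iter k S).
Proof. by elim: k => // k IH x; rewrite iterSr iterS TK IH. Qed.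

Let iterSK k : cancel (iter k S) (iter k T).
Proof. by elim: k => // k IH x; rewrite iterSr iterS SK IH. Qed.

Lemma zimage_oppE (i : int) (A : set X) : zimage T (- i) A = int_iter i @^-1` A.
Proof.
case: i => [[|k]|k] /=.
- by apply/seteqP; split=> [x [y Ay <-]//|x Ax]; exists x.
- by [].
- apply/seteqP; split=> x.
    by move=> [y Ay <-]; move: (iterTK k.+1 y) => /= ->.
  by move=> Ax; exists (iter k.+1 S x) => //; exact: (iterSK k.+1).
Qed.

Lemma zimageE (i : int) (A : set X) : zimage T i A = int_iter (- i) @^-1` A.
Proof. by rewrite -zimage_oppE opprK. Qed.

Lemma int_iterK (i : int) : cancel (int_iter i) (int_iter (- i)).
Proof.
case: i => [[|k]|k] //; first exact: (iterTK k.+1).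
by rewrite NegzE opprK; exact: (iterSK k.+1).
Qed.

Lemma int_iter_comm (i : int) (k : nat) (x : X) :
  int_iter i (iter k T x) = iter k T (int_iter i x).
Proof.
case: i => [n|n]; first by rewrite /int_iter -!iterD addnC.
have iterS_T j y : iter j S (T y) = T (iter j S y).
  by elim: j => // j IH; rewrite [LHS]/= IH TK [RHS]/= SK.
rewrite /int_iter; elim: k => // k IH.
by rewrite [iter k.+1 T x]/= iterS_T IH.
Qed.

Lemma window_cyls_cylinders (alpha : set (set X)) (n : nat) (C : set X) :
  window_cyls int_iter alpha n C -> cylinders T alpha C.
Proof.
(* Cylinder indices start at 1, so the shift by [-(n + 1)] carries [1, ..., 2n + 1] onto
   [-n, ..., n]. *)
move=> [f fa ->]; exists (2 * n).+1, (- n.+1%:Z), (fun j => f (j%:Z - n.+1%:Z)).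
split=> [//|j jN|]; first by apply: fa; rewrite /window/=; lia.
apply/seteqP; split=> x Cx.
  by move=> j /= jN; rewrite zimage_oppE; apply: Cx; rewrite /window/=; lia.
move=> i iw; rewrite /window/= in iw.
have := Cx (absz (i + n.+1%:Z)%R); rewrite /= zimage_oppE.
have -> : (absz (i + n.+1%:Z)%R)%:Z - n.+1%:Z = i by lia.
by apply; lia.
Qed.

Lemma cylinder_itinerary (alpha : set (set X)) (C : set X) :
  cylinders T alpha C ->
  exists n k f, [/\ forall i, k < i <= k + n%:Z -> alpha (f i), (0 < n)%N
    & C = itinerary_cyl int_iter [set i | k < i <= k + n%:Z] f].
Proof.
(* On the window [i - k] is positive, so [absz] merely casts it to [nat]. *)
move=> [n [k [a [n_gt0 aa ->]]]]; exists n, k, (fun i => a (absz (i - k)%R)).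
split=> [i ik|//|]; first by apply: aa; lia.
apply/seteqP; split=> x Cx.
  move=> i /= ik; have := Cx (absz (i - k)%R); rewrite /= zimage_oppE.
  have -> : (absz (i - k)%R)%:Z + k = i by lia.
  by apply; lia.
move=> j /= jN; rewrite zimage_oppE.
have := Cx (j%:Z + k); rewrite /=.
have -> : absz (j%:Z + k - k)%R = j by lia.
by apply; lia.
Qed.

End integer_iterates.

(** * Weak rational ergodicity on subsets, and extension of mixing from a pi-system *)

Section mixing.
Context {R : realType} {d : measure_display} {X : measurableType d}.
Variables (m : {measure set X -> \bar R}) (T : X -> X) (K : set nat).
Hypothesis T_mp : measure_preserving m T.

Lemma measurable_iter (k : nat) : measurable_fun setT (iter k T).
Proof.
have [mT _] := T_mp.
elim: k => [|k IH]; first exact: measurable_id.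
exact: (measurableT_comp mT IH).
Qed.

Lemma measure_preserving_iter (k : nat) : measure_preserving m (iter k T).
Proof.
split=> [|A mA]; first exact: measurable_iter.
elim: k => // k IH; have [_ Tm] := T_mp.
rewrite (_ : iter k.+1 T @^-1` A = T @^-1` (iter k T @^-1` A)); last first.
  by apply/seteqP; split=> x; rewrite /preimage/= -iterSr.
by rewrite Tm ?IH//; exact: preimage_measurable (measurable_iter k) mA.
Qed.

Lemma u_ge0 (F : set X) (k : nat) : 0 <= u_ m T F k.
Proof. by rewrite divr_ge0 ?sqr_ge0 ?fine_ge0. Qed.

(** The term for [k = 0] is already $1/m(F)$. *)
Lemma a_gt0 (F : set X) (n : nat) : pos_finite m F -> (0 < n)%N -> 0 < a_ m T F n.
Proof.
move=> [_ F_gt0 Ffin]; case: n => // n _.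
rewrite /a_ big_nat_recl// ltr_pwDl ?sumr_ge0// => [|i _]; last exact: u_ge0.
have mF_gt0 : 0 < fine (m F) by rewrite fine_gt0// F_gt0.
by rewrite /u_ /= setIid divr_gt0 ?exprn_gt0.
Qed.

Lemma near_within_gt0 : \forall n \near within K \oo, (0 < n)%N.
Proof. by exists 1%N. Qed.

(** Pulling back by [psi] moves subsets of [O] into [F] and preserves every $m(B\cap T^{-k}C)$,
    since [psi] commutes with [T]. Averages on [O] thus converge when normalized by $a_n(F)$; it
    remains to replace this by $a_n(O)$. *)
Lemma wre_along_sub_translate (F O : set X) (phi psi : X -> X) :
  pos_finite m O -> pos_finite m F -> wre_along m T K F ->
  measurable_fun setT psi -> (forall A, measurable A -> m (psi @^-1` A) = m A) ->
  cancel psi phi -> (forall k x, psi (iter k T x) = iter k T (psi x)) ->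
  O `<=` phi @^-1` F ->
  wre_along m T K O.
Proof.
move=> posO posF wreF mpsi psim psiK psiT OF.
have [mO O_gt0 Ofin] := posO.
have avgF B C : measurable B -> measurable C -> B `<=` O -> C `<=` O ->
    (fun n => (a_ m T F n)^-1 *
              \sum_(0 <= k < n) fine (m (B `&` iter k T @^-1` C)))
      @ within K \oo --> fine (m B) * fine (m C).
  move=> mB mC BO CO.
  have sub A : A `<=` O -> psi @^-1` A `<=` F.
    by move=> AO x /AO/OF; rewrite /preimage/= psiK.
  have := wreF (psi @^-1` B) (psi @^-1` C) (preimage_measurable _ _ mpsi mB)
    (preimage_measurable _ _ mpsi mC) (sub _ BO) (sub _ CO).
  rewrite !psim//; apply: cvg_trans; apply: near_eq_cvg; apply: nearW => n.
  congr (_ * _); apply: eq_bigr => k _; congr fine.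
  rewrite -(psim (B `&` _)); last first.
    by apply: measurableI => //; exact: preimage_measurable (measurable_iter k) mC.
  by congr (m _); apply/seteqP; split=> x [/= Bx]; rewrite psiT.
move=> B C mB mC BO CO.
have mO_neq0 : fine (m O) != 0 by rewrite gt_eqF// fine_gt0// O_gt0.
(* Taking both sets equal to [O], the averages are $m(O)^2 a_n(O)/a_n(F)$ and their limit is
   $m(O)^2$. *)
have ratio : (fun n => (a_ m T F n)^-1 * a_ m T O n) @ within K \oo --> (1 : R).
  have := cvgM (avgF O O mO mO (@subset_refl _ _) (@subset_refl _ _))
    (cvg_cst (fine (m O) ^+ 2)^-1).
  move=> /(_ _ _); rewrite -expr2 divff ?expf_neq0//.
  apply: cvg_trans; apply: near_eq_cvg; apply: nearW => n.
  by rewrite /= -mulrA mulr_suml.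
have := cvgM (avgF B C mB mC BO CO) (cvgV (oner_neq0 _) ratio).
move=> /(_ _ _); rewrite invr1 mulr1; apply: cvg_trans; apply: near_eq_cvg.
near=> n; rewrite /= invfM invrK mulrACA mulVf ?mul1r 1?mulrC//.
rewrite gt_eqF// a_gt0//; near: n; exact: near_within_gt0.
Unshelve. all: by end_near.
Qed.

(** Two passes of the pi-lambda argument: first the second set is extended to the sigma-algebra with
    the first in [P] or the whole space, then the first is extended with the second arbitrary. The
    whole space is included because a lambda-system must contain it. *)
Lemma mixing_dev_pi_system (O : set X) (P : set (set X)) :
  pos_finite m O -> wre_along m T K O ->
  setI_closed P -> P `<=` measurable ->
  (forall A B, P A \/ A = setT -> P B \/ B = setT ->
     mixing_dev m T O (O `&` A) (O `&` B) @ within K \oo --> (0 : R)) ->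
  forall A B, <<s P >> A -> <<s P >> B ->
    [/\ measurable A, measurable B &
       mixing_dev m T O (O `&` A) (O `&` B) @ within K \oo --> (0 : R)].
Proof.
move=> posO wreO PI mP Pdev; have [mO O_gt0 Ofin] := posO.
have lty A : measurable A -> (m (O `&` A) < +oo)%E.
  by move=> mA; apply: (measure_lty_subset _ _ O) => //; exact: measurableI.
have mpre k B : measurable B -> measurable (iter k T @^-1` B).
  exact: preimage_measurable (measurable_iter k).
have a_near : \forall n \near within K \oo, 0 < \sum_(0 <= k < n) u_ m T O k.
  by apply: filterS near_within_gt0 => n; exact: a_gt0.
have mPT A : P A \/ A = setT -> measurable A by move=> [/mP//|->].
have step1 A B : P A \/ A = setT -> <<s P >> B -> measurable B /\
    mixing_dev m T O (O `&` A) (O `&` B) @ within K \oo --> (0 : R).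
  move=> PA; have mA := mPT _ PA; have mOA := measurableI _ _ mO mA.
  (* Building $T^{-k}O$ into [E k] lets the varying set [D] range over all of [X] while only [O] ∩
     [D] is measured. *)
  pose E k := (O `&` A) `&` iter k T @^-1` O.
  have EE k D : E k `&` iter k T @^-1` D = (O `&` A) `&` iter k T @^-1` (O `&` D).
    by rewrite /E -setIA.
  have devE D : averaged_dev m E (fun k => iter k T) O (fine (m (O `&` A)))
      (u_ m T O) D = mixing_dev m T O (O `&` A) (O `&` D).
    apply/funext => n; rewrite /averaged_dev /mixing_dev; congr (_ * _).
    by apply: eq_bigr => k _; rewrite EE.
  rewrite -devE; apply: averaged_dev_cvg0 => //.
  - by move=> k; apply: measurableI => //; exact: mpre.
  - move=> k; rewrite /E -setIA; apply: lty; apply: measurableI => //; exact: mpre.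
  - exact: measurable_iter.
  - by move=> k; exact: u_ge0.
  - move=> D mD; have := wreO _ _ mOA (measurableI _ _ mO mD)
      (@subIsetl _ _ _) (@subIsetl _ _ _).
    apply: cvg_trans; apply: near_eq_cvg; apply: nearW => n.
    by congr (_ * _); apply: eq_bigr => k _; rewrite /= EE.
  - by move=> D PD; rewrite devE; apply: Pdev => //; left.
  - by rewrite devE; apply: Pdev => //; right.
move=> A B PA PB; have [mB _] := step1 setT B (or_intror erefl) PB.
have mOB := measurableI _ _ mO mB.
(* Roles exchanged: the fixed second set is absorbed into [E k], and the varying first set is pulled
   back by the identity. *)
pose E k := O `&` iter k T @^-1` (O `&` B).
have EE k D : E k `&` id @^-1` D = (O `&` D) `&` iter k T @^-1` (O `&` B).
  by rewrite /E setIAC.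
have devE D : averaged_dev m E (fun=> id) O (fine (m (O `&` B)))
    (u_ m T O) D = mixing_dev m T O (O `&` D) (O `&` B).
  apply/funext => n; rewrite /averaged_dev /mixing_dev; congr (_ * _).
  by apply: eq_bigr => k _; rewrite EE [fine (m (O `&` B)) * _]mulrC.
suff [mA devA] : measurable A /\ averaged_dev m E (fun=> id) O
    (fine (m (O `&` B))) (u_ m T O) A @ within K \oo --> (0 : R).
  by split=> //; rewrite -devE.
apply: averaged_dev_cvg0 PA => //.
- by move=> k; apply: measurableI => //; exact: mpre.
- move=> k; apply: lty; exact: mpre.
- by move=> k; exact: u_ge0.
- move=> D mD; have := wreO _ _ (measurableI _ _ mO mD) mOB
    (@subIsetl _ _ _) (@subIsetl _ _ _).
  rewrite mulrC; apply: cvg_trans; apply: near_eq_cvg; apply: nearW => n.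
  by congr (_ * _); apply: eq_bigr => k _; rewrite EE.
- by move=> D PD; rewrite devE; have [] := step1 D B (or_introl PD) PB.
- by rewrite devE; have [] := step1 setT B (or_intror erefl) PB.
Qed.

Lemma eq_measure_null (A B N : set X) :
  measurable A -> measurable B -> measurable N -> m N = 0%E ->
  A `<=` B `|` N -> B `<=` A `|` N -> m A = m B.
Proof.
move=> mA mB mN N0.
have le C D : measurable C -> measurable D -> C `<=` D `|` N -> (m C <= m D)%E.
  move=> mC mD CD; rewrite -(measureU0 mD mN N0).
  by apply: le_measure; rewrite ?inE//; exact: measurableU.
by move=> AB BA; apply/eqP; rewrite eq_le !le.
Qed.

(** The two intersections differ only inside $(A\triangle A')\cup T^{-k}(B\triangle B')$, which is
    null because [T] preserves [m]. This handles generation modulo [m]. *)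
Lemma mixing_dev_null_eq (O A A' B B' : set X) :
  measurable A -> measurable A' -> measurable B -> measurable B' ->
  m (A `+` A') = 0%E -> m (B `+` B') = 0%E ->
  mixing_dev m T O A B = mixing_dev m T O A' B'.
Proof.
move=> mA mA' mB mB' nA nB.
have sub (C C' : set X) : C `<=` C' `|` (C `+` C').
  by move=> x Cx; have [|] := pselect (C' x); [left|right; left].
have sub' (C C' : set X) : C' `<=` C `|` (C `+` C').
  by move=> x Cx; have [|] := pselect (C x); [left|right; right].
have mY (C D : set X) : measurable C -> measurable D -> measurable (C `+` D).
  by move=> mC mD; rewrite /setY; apply: measurableU; exact: measurableD.
have mpre k C : measurable C -> measurable (iter k T @^-1` C).
  exact: preimage_measurable (measurable_iter k).
have pre0 k C : measurable C -> m (iter k T @^-1` C) = m C.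
  by have [_] := measure_preserving_iter k; exact.
apply/funext => n; congr (_ * _); apply: eq_bigr => k _.
rewrite (@eq_measure_null A A' (A `+` A'))//; [|exact: mY].
rewrite (@eq_measure_null B B' (B `+` B'))//; [|exact: mY].
congr (`|fine _ - _|).
have mN : measurable (iter k T @^-1` (B `+` B')) by apply: mpre; exact: mY.
apply: (@eq_measure_null _ _ ((A `+` A') `|` iter k T @^-1` (B `+` B'))).
- by apply: measurableI => //; exact: mpre.
- by apply: measurableI => //; exact: mpre.
- by apply: measurableU => //; exact: mY.
- by rewrite measureU0 ?pre0//; exact: mY.
- move=> x [/(sub A A')[A'x|]]; last by right; left.
  by move=> /(sub B B')[B'x|]; [left|right; right].
- move=> x [/(sub' A A')[A'x|]]; last by right; left.
  by move=> /(sub' B B')[B'x|]; [left|right; right].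
Qed.

End mixing.

(** * Measure preservation by all integer powers *)

Section invertible.
Context {R : realType} {d : measure_display} {X : measurableType d}.
Variables (m : {measure set X -> \bar R}) (T S : X -> X).
Hypotheses (T_mp : measure_preserving m T) (TK : cancel T S) (SK : cancel S T).
Hypothesis mS : measurable_fun setT S.

Lemma measure_preserving_inverse : measure_preserving m S.
Proof.
split=> // A mA; have [_ Tm] := T_mp.
rewrite -[LHS]Tm; last exact: preimage_measurable.
by congr (m _); apply/seteqP; split=> x; rewrite /preimage/= TK.
Qed.

Lemma measure_preserving_int_iter (i : int) :
  measure_preserving m (int_iter T S i).
Proof.
case: i => k; apply: measure_preserving_iter => //.
exact: measure_preserving_inverse.
Qed.

End invertible.

(** * Rational weak mixing on [Omega] *)

Theorem rationally_weakly_mixing_cylinders (R : realType) (d : measure_display)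
    (X : measurableType d) (m : {measure set X -> \bar R}) (T : X -> X)
    (K : set nat) (alpha : set (set X)) (Omega : set X) :
  measure_preserving m T -> invertible T -> weakly_rationally_ergodic m T K ->
  countable alpha -> partition alpha id [set: X] ->
  alpha `<=` wre_sets m T K -> generates m T alpha ->
  cylinders T alpha Omega -> (0 < m Omega)%E ->
  (forall A B, cylinders T alpha A -> cylinders T alpha B ->
     mixing_dev m T Omega A B @ within K \oo --> (0 : R)) ->
  rationally_weakly_mixing m T K.
Proof.
move=> Tmp [S [TK SK mS]] [Tcons Terg _] alphaC alphaP alphaR gen cylO O_gt0 mix.
have int_mp := measure_preserving_int_iter m T S Tmp TK mS.
have [N [k [f [fa N_gt0 OE]]]] := cylinder_itinerary T S TK SK alpha Omega cylO.
set phi := int_iter T S in OE int_mp *.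
have malpha a : alpha a -> measurable a by move=> /alphaR[].
have mcyl J h : (forall i, J i -> alpha (h i)) ->
    measurable (itinerary_cyl phi J h).
  (* By complements, the intersection becomes a union over the countable type [int]. *)
  move=> ha; rewrite /itinerary_cyl bigcap_mkcond -[X in measurable X]setCK.
  rewrite setC_bigcap; apply/measurableC/countable_bigcupT_measurable => // i.
  apply: measurableC; case: ifPn => // /set_mem Ji.
  by apply: preimage_measurable (malpha _ (ha i Ji)); have [] := int_mp i.
have mO : measurable Omega by rewrite OE; exact: mcyl.
(* The block at the first time of the window of [Omega], which is [k + 1] because the window
   excludes [k]. *)
pose F := f (k + 1).
have aF : alpha F by apply: fa; lia.
have [mF Ffin Fwre] := alphaR _ aF.
have OF : Omega `<=` phi (k + 1) @^-1` F.
  by rewrite OE => x /(_ (k + 1)); apply => /=; lia.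
have OFle : (m Omega <= m F)%E.
  have [mphi phim] := int_mp (k + 1); rewrite -(phim F mF).
  by apply: le_measure; rewrite ?inE//; exact: preimage_measurable.
have F_gt0 : (0 < m F)%E := lt_le_trans O_gt0 OFle.
have posF : pos_finite m F by [].
have posO : pos_finite m Omega by split=> //; exact: le_lt_trans OFle Ffin.
(* Positivity of [m F] rules out the null-set convention in [wre_sets]. *)
have {}Fwre : wre_along m T K F by case: Fwre => // F0; rewrite F0 ltxx in F_gt0.
have wreO : wre_along m T K Omega.
  have [mpsi psim] := int_mp (- (k + 1)).
  apply: (wre_along_sub_translate m T K Tmp F Omega
    (phi (k + 1)) (phi (- (k + 1)))) => //.
    by have := int_iterK T S TK SK (- (k + 1)); rewrite opprK.
  by move=> j x; exact: int_iter_comm.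
(* Large enough for $[-n_0,n_0]$ to contain the window $k<i\le k+N$ of [Omega]. *)
pose n0 := (`|k| + N)%N.
pose P := window_pi_system phi alpha n0.
have PI : setI_closed P by exact: window_pi_system_setI.
have mP : P `<=` measurable.
  by move=> C [->//|[n _ [h ha ->]]]; exact: mcyl.
(* A member of [P] lies inside [Omega] or misses it, so intersecting with [Omega] yields a cylinder
   or the empty set; the assumption on cylinders then covers all pairs. *)
have Pcyl C : P C \/ C = setT ->
    Omega `&` C = set0 \/ cylinders T alpha (Omega `&` C).
  move=> [[->|[n n0n WC]]|->]; [by left; rewrite setI0| |by right; rewrite setIT].
  have [h ha CE] := WC.
  have sub : [set i | k < i <= k + N%:Z] `<=` window n.
    by move=> i /=; rewrite /window/=; lia.
  have [] := itinerary_cyl_sub_or_disjoint phi alpha alphaP _ _ f h sub fa ha.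
    rewrite -CE -OE => /setIidr ->; right.
    exact: window_cyls_cylinders TK SK alpha n C WC.
  by rewrite -CE -OE setIC => ->; left.
have dev0 A B : A = set0 \/ B = set0 ->
    mixing_dev m T Omega A B @ within K \oo --> (0 : R).
  move=> AB0; rewrite (_ : mixing_dev _ _ _ _ _ = cst 0); first exact: cvg_cst.
  apply/funext => n; rewrite /mixing_dev big1 ?mulr0// => j _.
  by case: AB0 => ->;
    rewrite ?preimage_set0 ?set0I ?setI0 measure0 /= ?mulr0 !mul0r subr0 normr0.
have Pdev A B : P A \/ A = setT -> P B \/ B = setT ->
    mixing_dev m T Omega (Omega `&` A) (Omega `&` B) @ within K \oo --> (0 : R).
  move=> /Pcyl[A0 _|cA /Pcyl[B0|cB]]; [by apply: dev0; left| |exact: mix].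
  by apply: dev0; right.
have genP : <<s [set zimage T n a | n in [set: int] & a in alpha] >> `<=` <<s P >>.
  apply: smallest_sub; first exact: smallest_sigma_algebra.
  move=> _ [n _ [a aa <-]]; rewrite (zimageE T S TK SK).
  exact: window_pi_system_generates.
split=> //; exists Omega => // A B mA mB AO BO.
have [A0 /genP PA0 nA] := gen A mA.
have [B0 /genP PB0 nB] := gen B mB.
have [mA0 mB0 dev] :=
  mixing_dev_pi_system m T K Tmp Omega P posO wreO PI mP Pdev
    A0 B0 PA0 PB0.
(* Since [C] lies in [Omega], cutting its approximant [C0] down to [Omega] only shrinks the
   symmetric difference. *)
have null C C0 : measurable C -> measurable C0 -> C `<=` Omega ->
    m (C0 `+` C) = 0%E -> m (C `+` (Omega `&` C0)) = 0%E.
  move=> mC mC0 CO C0C; apply: subset_measure0 C0C.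
  - rewrite /setY; apply: measurableU; apply: measurableD => //;
      exact: measurableI.
  - by rewrite /setY; apply: measurableU; exact: measurableD.
  - move=> x [[Cx nx]|[[Ox C0x] nx]]; last by left.
    by right; split=> // C0x; apply: nx; split=> //; exact: CO.
rewrite (@mixing_dev_null_eq _ _ _ m T Tmp Omega A (Omega `&` A0)
  B (Omega `&` B0))//.
- exact: measurableI.
- exact: measurableI.
- exact: null.
- exact: null.
Qed.

Theorem lemmaC (R : realType) (X : ptopologicalType) (polX : polish R X)
    (m : {measure set (borel X) -> \bar R})
    (m_sigma_finite : sigma_finite setT m)
    (m_non_atomic : non_atomic m)
    (m_infinite : m setT = +oo%E)
    (T : borel X -> borel X)
    (T_mp : measure_preserving m T)
    (T_inv : invertible T)
    (K : set nat) (K_infinite : infinite_set K)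
    (T_wre : weakly_rationally_ergodic m T K)
    (alpha : set (set (borel X)))
    (alpha_countable : countable alpha)
    (alpha_partition : partition alpha id [set: borel X])
    (alpha_R : alpha `<=` wre_sets m T K)
    (alpha_generates : generates m T alpha)
    (Omega : set (borel X))
    (Omega_cyl : cylinders T alpha Omega)
    (Omega_pos : (0 < m Omega)%E)
    (mixing_cyl : forall A B, cylinders T alpha A -> cylinders T alpha B ->
       mixing_dev m T Omega A B @ within K \oo --> (0 : R)) :
  rationally_weakly_mixing m T K.
Proof.
exact: (@rationally_weakly_mixing_cylinders R _ _ m T K alpha Omega).
Qed.
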